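(* For all integers $n \geq 1$ and $i \geq 1$, the total number of vertices of degree $i$ among all plane trees with $n$ edges (that is, the number of pairs $(T,v)$ where $T$ is a plane tree with $n$ edges and $v$ is a vertex of $T$ of degree $i$) is $$2\binom{2n-i-1}{n-1}.$$
   Context: A plane tree is a (nonempty, finite) rooted tree, with unlabelled (indistinguishable) vertices, in which the subtrees at every vertex are linearly ordered; plane trees are counted up to isomorphism preserving the root and these orders. The degree of a vertex $v$ is the total number of vertices adjacent to $v$ (so it equals the number of children of $v$ if $v$ is the root, and the number of children plus one otherwise). The vertices of a given tree are counted as distinct positions in the tree. Convention: $\binom{a}{b}=0$ unless $0\le b\le a$. *)

(* Defs.v *)
From mathcomp Require Import all_boot all_order all_algebra.
From mathcomp Require Import boolp classical_sets functions cardinality.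

Set Implicit Arguments.
Unset Strict Implicit.
Unset Printing Implicit Defensive.

Import Order.TTheory GRing.Theory Num.Theory.

(* The plane trees up to isomorphism: a root with a finite, linearly ordered
   list of subtrees.  Leibniz equality is root- and order-preserving
   isomorphism. *)
Inductive ptree : Type := Node of seq ptree.

(* A vertex is encoded by its position: the sequence of child indices
   (counted from 0) along the path from the root, the root being [::]. *)
Fixpoint vertices (t : ptree) : seq (seq nat) :=
  let: Node ts := t in
  [::] :: flatten [seq [seq kvs.1 :: v | v <- kvs.2]
                  | kvs <- zip (iota 0 (size ts)) [seq vertices t' | t' <- ts]].

Definition parent (u v : seq nat) : bool := v == rcons u (last 0 v).

Lemma parentP u v : reflect (exists k, v = rcons u k) (parent u v).
Proof.
by apply: (iffP eqP) => [->|[k ->]]; [exists (last 0 v)|rewrite last_rcons].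
Qed.

Definition adjacent (u v : seq nat) : bool := parent u v || parent v u.

Definition nb_edges (t : ptree) : nat :=
  size [seq e <- [seq (u, v) | u <- vertices t, v <- vertices t]
       | parent e.1 e.2].

Definition degree (t : ptree) (v : seq nat) : nat :=
  count (adjacent v) (vertices t).

(* The list [vertices t] has no repetition, so that the two counts above are
   cardinalities. *)
Lemma vertices_uniq t : uniq (vertices t).
Proof.
move: t; fix IH 1 => -[ts] /=; apply/andP; split.
  by apply/negP => /flattenP[s /mapP[kvs _ ->]] /mapP[].
have : all uniq [seq vertices t' | t' <- ts].
  by elim: ts => //= t ts IHts; rewrite IH.
rewrite -(size_map vertices); move: [seq vertices t' | t' <- ts] => vss.
elim: vss 0 => //= vs vss IHvss k /andP[uvs uvss].
rewrite cat_uniq IHvss // andbT map_inj_uniq ?uvs /=; last first.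
  by move=> u v [].
apply/hasPn => w /flattenP[s /mapP[[j us] jus ->]] /mapP[u _ ->] /=.
apply/mapP => -[v _ [jk _]].
have : j \in iota k.+1 (size vss).
  have := map_f fst jus; rewrite -/(unzip1 _) unzip1_zip ?size_iota //.
by rewrite mem_iota jk ltnn.
Qed.

(* Binomial coefficients with integer arguments, so that the upper argument
   may be negative: no truncated subtraction is involved. *)
Definition binz (a b : int) : nat :=
  if (0 <= b <= a)%R then 'C(`|a|, `|b|) else 0.

(* Main.v *)
(* Let [m = n - i].  Cutting a tree along the path from the root to a vertex at
   depth [d] with [c] children leaves a sequence of [c + 2 d] trees, and this is
   a bijection.  The sequences of [k] trees with [m] edges in all are counted by
   ballot numbers, which are differences of consecutive binomial coefficients,
   so that the sum over [d] telescopes: the non-root vertices ([c = i - 1] and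
   [d > 0]) contribute C(2m + i, m), and the roots ([c = i] and [d = 0])
   contribute C(2m + i - 1, m) - C(2m + i - 1, m - 1).  By Pascal's rule the
   total is 2 C(2m + i - 1, m). *)
Require Import Defs.
From mathcomp Require Import all_boot all_order all_algebra finmap zify.
From mathcomp Require Import boolp classical_sets functions cardinality.

Local Open Scope classical_set_scope.
Local Open Scope card_scope.

(** * Cardinality of disjoint unions *)

Lemma card_setU_disj (T : choiceType) (A B : set T) (a b : nat) :
  A #= `I_a -> B #= `I_b -> A `&` B = set0 -> A `|` B #= `I_(a + b).
Proof.
move=> Aa Bb AB0.
have finA : finite_set A by exists a.
have finB : finite_set B by exists b.
rewrite -[A `|` B]fset_setK ?finite_setU //.
apply/card_eq_fsetP; rewrite fset_setU // cardfsU -fset_setI // AB0.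
by rewrite fset_set0 cardfs0 subn0 (card_fset_set Aa) (card_fset_set Bb).
Qed.

(** Each decomposition below exhibits a set as two disjoint injective images; this turns it into an
    addition of cardinals. *)
Lemma card_setU_image (T U V : Type) (A : set T) (B : set U) (C : set V)
    (f : T -> V) (g : U -> V) (a b : nat) :
  A #= `I_a -> B #= `I_b -> set_inj A f -> set_inj B g ->
  (forall x y, A x -> B y -> f x <> g y) -> C = f @` A `|` g @` B ->
  C #= `I_(a + b).
Proof.
move=> Aa Bb injf injg fg ->; apply: (@card_setU_disj {classic V}).
- by apply: card_eq_trans Aa; exact: inj_card_eq.
- by apply: card_eq_trans Bb; exact: inj_card_eq.
- by apply/seteqP; split=> // _ [[x Ax <-] [y By]] /esym; apply: fg.
Qed.

(** * Vertex positions and sizes of trees and forests *)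

Definition leaf : ptree := Node [::].
Definition nb_vertices (t : ptree) : nat := size (vertices t).
Definition forest_size (s : seq ptree) : nat := sumn (map nb_vertices s).

Lemma nb_vertices_Node ts : nb_vertices (Node ts) = (forest_size ts).+1.
Proof.
rewrite /nb_vertices /forest_size /= size_flatten /shape -map_comp.
congr (sumn _).+1; move: 0.
by elim: ts => //= t ts IH k; rewrite size_map IH.
Qed.

Lemma nb_vertices_leaf : nb_vertices leaf = 1.
Proof. by []. Qed.

Lemma root_vertices t : [::] \in vertices t.
Proof. by case: t. Qed.

Lemma nb_vertices_gt0 t : 0 < nb_vertices t.
Proof. by case: t => ts; rewrite nb_vertices_Node. Qed.

Lemma leq_forest_size s : size s <= forest_size s.
Proof.
elim: s => //= t s IH; rewrite /forest_size /= -add1n.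
exact: leq_add (nb_vertices_gt0 t) IH.
Qed.

Lemma mem_cons_vertices k v ts :
  (k :: v \in vertices (Node ts)) =
  (k < size ts) && (v \in vertices (nth leaf ts k)).
Proof.
rewrite /= in_cons /= -[k in LHS]add0n; move: 0 => j.
elim: ts k j => [|t ts IH] k j //=.
rewrite mem_cat; case: k => [|k].
  rewrite addn0 /= mem_map => [|x y []//].
  case: (v \in vertices t) => //=.
  (* Positions in the later subtrees begin with an index above [j]. *)
  apply/negP => /flattenP[_ /mapP[[i us] ius ->]] /mapP[u _ /= [ji _]].
  have : i \in iota j.+1 (size ts).
    have := map_f fst ius; rewrite -/(unzip1 _) unzip1_zip ?size_iota //.
    by rewrite size_map.
  by rewrite mem_iota ji ltnn.
rewrite -addSnnS IH /= ltnS.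
suff -> : (j.+1 + k :: v \in [seq j :: v0 | v0 <- vertices t]) = false by [].
by apply/mapP => -[u _ []]; lia.
Qed.

(** * Cutting a tree along a path, and the inverse regluing *)

(* Cutting the tree along the path to a vertex: each level of the path leaves
   the forests on either side of it, each grafted on a new root, and the last
   level leaves the subtrees at the vertex itself. *)
Fixpoint spread (v : seq nat) (t : ptree) : seq ptree :=
  let: Node ts := t in
  if v is k :: v'
  then [:: Node (take k ts), Node (drop k.+1 ts) & spread v' (nth leaf ts k)]
  else ts.

(** Inverse of [spread] once the depth [d] is known. The fallback with [d > 0] only concerns lists
    that are too short, excluded by [d.*2 <= size s]. *)
Fixpoint fill (d : nat) (s : seq ptree) : ptree * seq nat :=
  match d, s with
  | d'.+1, [:: Node l, Node r & s'] =>
      let: (t, v) := fill d' s' in (Node (l ++ t :: r), size l :: v)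
  | _, _ => (Node s, [::])
  end.

Lemma size_fill d s : d.*2 <= size s -> size (fill d s).2 = d.
Proof.
elim: d s => [|d IH] [|[l] [|[r] s]] //=.
by rewrite !ltnS; case: fill (IH s) => t v /= H /H ->.
Qed.

Lemma fill_vertices d s : d.*2 <= size s ->
  (fill d s).2 \in vertices (fill d s).1.
Proof.
elim: d s => [|d IH] [|[l] [|[r] s]] //; rewrite /fill -/fill ltnS => ds.
case: fill (IH s ds) => t v /= H.
by rewrite mem_cons_vertices size_cat /= nth_cat ltnn subnn H; lia.
Qed.

Lemma spread_fill d s : d.*2 <= size s ->
  spread (fill d s).2 (fill d s).1 = s.
Proof.
elim: d s => [|d IH] [|[l] [|[r] s]] //=; rewrite !ltnS => ds.
case: fill (IH s ds) => t v /= H.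
rewrite take_size_cat // nth_cat ltnn subnn /= H drop_cat ltnNge leqnSn /=.
by rewrite subSnn drop1.
Qed.

Lemma fill_spread v t : v \in vertices t -> fill (size v) (spread v t) = (t, v).
Proof.
elim: v t => [|k v IH] [ts] //; rewrite mem_cons_vertices => /andP[kts vt] /=.
rewrite IH // size_takel 1?ltnW //; congr (Node _, _).
by rewrite -drop_nth // cat_take_drop.
Qed.

Lemma size_spread v t : (size v).*2 <= size (spread v t).
Proof. by elim: v t => [|k v IH] [ts] //=; rewrite !ltnS. Qed.

Lemma forest_size_cat s1 s2 :
  forest_size (s1 ++ s2) = forest_size s1 + forest_size s2.
Proof. by rewrite /forest_size map_cat sumn_cat. Qed.

Lemma forest_size_cons t s : forest_size (t :: s) = nb_vertices t + forest_size s.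
Proof. by []. Qed.

(** Each level of the path replaces one vertex by two new roots, a gain of 1; the last step deletes
    the vertex itself. *)
Lemma forest_size_spread v t : v \in vertices t ->
  forest_size (spread v t) = (nb_vertices t).-1 + size v.
Proof.
elim: v t => [|k v IH] [ts]; first by rewrite nb_vertices_Node addn0.
rewrite mem_cons_vertices => /andP[kts vt].
rewrite [spread _ _]/= !forest_size_cons !nb_vertices_Node IH //=.
have -> : forest_size ts = forest_size (take k ts)
    + (nb_vertices (nth leaf ts k) + forest_size (drop k.+1 ts)).
  by rewrite -{1}(cat_take_drop k ts) (drop_nth leaf) // forest_size_cat.
have := nb_vertices_gt0 (nth leaf ts k).
lia.
Qed.

(** Past the two trees left by each level, the entries of [spread v t] are the subtrees at [v]. *)
Lemma mem_rcons_vertices v k t :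
  (rcons v k \in vertices t) =
  (v \in vertices t) && (k + (size v).*2 < size (spread v t)).
Proof.
elim: v t => [|j v IH] [ts].
  by rewrite mem_cons_vertices !root_vertices andbT addn0.
by rewrite rcons_cons !mem_cons_vertices IH andbA /= !addnS !ltnS.
Qed.

(** * Edges and degrees read off from the cutting *)

Lemma count_parents v t :
  v \in vertices t -> count (parent^~ v) (vertices t) = (v != [::]).
Proof.
case: (lastP v) => [|u k] vt.
  by apply/eqP; rewrite -leqn0 leqNgt -has_count; apply/hasP => -[[|? ?]].
have ut : u \in vertices t by move: vt; rewrite mem_rcons_vertices => /andP[].
rewrite (eq_count (a2 := pred1 u)).
  by rewrite count_uniq_mem ?vertices_uniq // ut; case: (u).
by move=> w; rewrite /parent last_rcons /= eqseq_rcons eqxx andbT eq_sym.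
Qed.

Lemma count_allpairs (T U : Type) (r : T -> U -> bool) (s1 : seq T) (s2 : seq U) :
  count (fun e => r e.1 e.2) [seq (u, v) | u <- s1, v <- s2] =
  \sum_(v <- s2) count (r^~ v) s1.
Proof.
elim: s1 => [|u s1 IH] /=; first by rewrite big1.
by rewrite count_cat count_map IH big_split /= -sum1_count big_mkcond.
Qed.

(** Edges are counted by their lower end: every vertex but the root has exactly one parent. *)
Lemma nb_edgesE t : nb_edges t = (nb_vertices t).-1.
Proof.
rewrite /nb_edges size_filter (count_allpairs _ _ parent) big_seq.
under eq_bigr => v vt do rewrite count_parents //.
rewrite -big_seq /nb_vertices; case: t => ts.
have := vertices_uniq (Node ts); rewrite /=; move: (flatten _) => s /andP[s0 _].
rewrite big_cons add0n -sum1_size big_seq [RHS]big_seq; apply: eq_bigr => v vs.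
by case: eqP s0 vs => // -> /negP.
Qed.

Lemma count_children v t : v \in vertices t ->
  count (parent v) (vertices t) + (size v).*2 = size (spread v t).
Proof.
move=> vt; rewrite addnC.
have -> : count (parent v) (vertices t) =
    size [seq rcons v k | k <- iota 0 (size (spread v t) - (size v).*2)].
  rewrite -size_filter; apply/perm_size/uniq_perm.
  - by rewrite filter_uniq ?vertices_uniq.
  - by rewrite map_inj_uniq ?iota_uniq //; exact: rcons_injr.
  move=> w; rewrite mem_filter; apply/andP/mapP => [[/parentP[k ->]]|[k]].
    rewrite mem_rcons_vertices => /andP[_ kv].
    by exists k => //; rewrite mem_iota; lia.
  rewrite mem_iota => kv ->; split; first by apply/parentP; exists k.
  by rewrite mem_rcons_vertices vt /= addnC -ltn_subRL.
by rewrite size_map size_iota subnKC // size_spread.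
Qed.

Lemma degreeE v t : v \in vertices t ->
  degree t v + (size v).*2 = size (spread v t) + (v != [::]).
Proof.
move=> vt; rewrite -(count_children _ _ vt) -(count_parents _ _ vt) addnAC.
congr (_ + _); rewrite /degree -count_predUI.
(* A child is longer than [v] and a parent shorter, so none is counted twice. *)
rewrite [X in _ = _ + X](eq_count (a2 := pred0)) ?count_pred0 ?addn0 //.
move=> u /=; apply/negP => /andP[/parentP[j uj] /parentP[k]].
by rewrite uj => /(congr1 size); rewrite !size_rcons; lia.
Qed.

(** * Sequences of [k] trees with [m] edges in all, and ballot numbers *)

Definition forests (k m : nat) : set (seq ptree) :=
  [set s | size s = k /\ forest_size s = k + m].

(* The images under [spread] of the vertices with [k] children at depth [ds.1],
   in trees with [m] edges besides those to these [k] children. *)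
Definition marked_forests (k m : nat) : set (nat * seq ptree) :=
  [set ds | size ds.2 = k + ds.1.*2
          /\ forest_size ds.2 + ds.1 = size ds.2 + m].

Definition graft (s : seq ptree) : seq ptree :=
  if s is [:: t, Node ts & s'] then Node (t :: ts) :: s' else s.

(** Either the first tree is a leaf, which is dropped, or its leftmost root edge is cut, giving one
    more tree and one edge fewer; [graft] restores that edge. *)
Lemma forestsSS k m :
  forests k.+1 m.+1 = cons leaf @` forests k m.+1 `|` graft @` forests k.+2 m.
Proof.
apply/seteqP; split=> [[|[[|t ts]] s] []//= [sk] sm|s].
- left; exists s => //; split=> //.
  by move: sm; rewrite forest_size_cons nb_vertices_leaf; lia.
- right; exists [:: t, Node ts & s] => //; split; first by rewrite /= sk.
  move: sm; rewrite !forest_size_cons !nb_vertices_Node forest_size_cons.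
  lia.
case=> [[s' [sk sm] <-]|[[|t [|[ts] s']] []//= [sk] sm <-]].
  by split; rewrite /= ?sk // forest_size_cons sm nb_vertices_leaf; lia.
split; rewrite /= ?sk //.
move: sm; rewrite !forest_size_cons !nb_vertices_Node forest_size_cons.
lia.
Qed.

Lemma forests_0S m : forests 0 m.+1 = set0.
Proof. by apply/seteqP; split=> // -[|t s] []. Qed.

Lemma forests_k0 k : forests k 0 = [set nseq k leaf].
Proof.
elim: k => [|k IH]; apply/seteqP; split => s.
- by case: s => // ? ? [].
- by move=> ->.
- case: s => [|[ts] s] []//= [sk]; rewrite forest_size_cons nb_vertices_Node => sm.
  have fk : forests k 0 s.
    by split=> //; have := leq_forest_size s; rewrite sk; lia.
  have -> : ts = [::].
    apply/nilP; rewrite /nilp; have := leq_forest_size ts.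
    by have := leq_forest_size s; rewrite sk; lia.
  by move: fk; rewrite IH => ->.
- move=> ->; have [sk sm] : forests k 0 (nseq k leaf) by rewrite IH.
  by split; rewrite /= ?sk // forest_size_cons nb_vertices_leaf sm; lia.
Qed.

Lemma card_set1_II (T : Type) (x : T) : [set x] #= `I_1.
Proof.
rewrite -[[set x]](@image_set1 nat _ (fun=> x) 0).
have -> : `I_1 = [set 0] by apply/seteqP; split=> -[].
by apply: inj_card_eq => y z; rewrite !inE => -> ->.
Qed.

(* The subtraction in the ballot number is moved to the left; both terms then
   satisfy the recurrence [forestsSS] by Pascal's rule. *)
Lemma card_forests k m :
  exists2 a, forests k m #= `I_a &
    a + (if m is m'.+1 then 'C((m.*2 + k).-1, m') else 0)
    = 'C((m.*2 + k).-1, m).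
Proof.
elim: m k => [|m IHm] k.
  by exists 1; rewrite ?bin0 // forests_k0; exact: card_set1_II.
elim: k => [|k [a ka aE]].
  exists 0; first by rewrite forests_0S II0.
  (* The count is 0 because the two binomials are equal by symmetry. *)
  rewrite doubleS addn0 add0n [LHS](_ : _ = 'C(m.*2.+1, m.*2.+1 - m)).
    by congr 'C(_, _); lia.
  by rewrite bin_sub //; lia.
have [b kb bE] := IHm k.+2.
exists (a + b).
  apply: (card_setU_image _ _ _ _ _ _ _ _ _ _ ka kb _ _ _ (forestsSS k m)).
  - by move=> s s' _ _ [].
  - move=> [|t [|[ts] s]] [|t' [|[ts'] s']] //; rewrite !inE => -[]//= _ _ []//= _ _.
    by case=> -> -> ->.
  - by move=> s [|t [|[ts] s']] _ [].
move: aE bE; rewrite !doubleS !addSn !addnS /= !binS.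
case: m {IHm kb ka} => [|m]; first by rewrite !bin0 !bin1; lia.
by rewrite !doubleS !addSn /= !binS; lia.
Qed.

(** A positive depth can be lowered by one with the sequence unchanged: two of its trees then count
    among the [k + 2], and [m] drops by one. *)
Lemma marked_forestsS k m :
  marked_forests k m.+1 =
  pair 0 @` forests k m.+1
  `|` (fun ds => (ds.1.+1, ds.2)) @` marked_forests k.+2 m.
Proof.
apply/seteqP; split=> [[[|d] s] /= []/= sk sm|_ [[s [sk sm] <-]|[[d s] [/= sk sm] <-]]].
- by left; exists s => //; split; lia.
- by right; exists (d, s) => //; split => /=; lia.
- by split => /=; lia.
- by split => /=; lia.
Qed.

Lemma marked_forests_k0 k : marked_forests k 0 = [set (0, nseq k leaf)].
Proof.
apply/seteqP; split=> [[d s] [/= sk sm]|_ ->] /=.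
  have d0 : d = 0 by have := leq_forest_size s; lia.
  have : forests k 0 s by split; lia.
  by rewrite forests_k0 d0 => ->.
have [sk sm] : forests k 0 (nseq k leaf) by rewrite forests_k0.
by split=> /=; lia.
Qed.

(** The telescoping: depth 0 gives C(2m+k, m) - C(2m+k, m-1), and by induction the positive depths
    give C(2(m-1)+k+2, m-1), the term subtracted. *)
Lemma card_marked_forests k m : marked_forests k.+1 m #= `I_('C(m.*2 + k, m)).
Proof.
elim: m k => [|m IH] k.
  by rewrite marked_forests_k0 bin0; exact: card_set1_II.
have [a ka] := card_forests k.+1 m.+1.
rewrite addnS /= => aE; rewrite -aE.
have kb := IH k.+2; rewrite !addnS -!addSn -doubleS in kb.
apply: (card_setU_image _ _ _ _ _ _ _ _ _ _ ka kb _ _ _ (marked_forestsS _ _)).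
- by move=> s s' _ _ [].
- by move=> [d s] [d' s'] _ _ /= [-> ->].
- by [].
Qed.

(** * Vertices of given degree as forests and marked forests *)

#[local] Arguments fill : simpl never.

(** A non-root vertex at depth [d + 1] has [i] children and leaves [i + 2(d + 1)] trees; reading
    this as [(i + 2) + 2d] makes the condition of positive depth disappear. *)
Lemma vertices_of_degreeE i m :
  [set Tv : ptree * seq nat | [/\ nb_edges Tv.1 = i.+1 + m,
                                  Tv.2 \in vertices Tv.1
                                & degree Tv.1 Tv.2 = i.+1]] =
  (fun s => (Node s, [::])) @` forests i.+1 m
  `|` (fun ds => fill ds.1.+1 ds.2) @` marked_forests i.+2 m.
Proof.
apply/seteqP; split=> [[t v] /= [tn vt ti]|_ [[s [sk sm] <-]|[[d s] [/= sk sm] <-]]].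
- have := degreeE _ _ vt; have := forest_size_spread _ _ vt.
  rewrite -nb_edgesE tn ti.
  case: v vt {ti} => [|k v] vt fs ds.
    left; case: t tn vt fs ds => ts _ _ /= fs ds.
    by exists ts => //; split; lia.
  right; exists (size v, spread (k :: v) t) => /=.
    by split=> /=; move: fs ds => /=; lia.
  by have := fill_spread _ _ vt.
- split; first by rewrite nb_edgesE nb_vertices_Node /=; lia.
    exact: root_vertices.
  by have := degreeE _ _ (root_vertices (Node s)); rewrite /= sk; lia.
have ds : d.+1.*2 <= size s by lia.
have vt := fill_vertices _ _ ds.
have := degreeE _ _ vt; have := forest_size_spread _ _ vt.
rewrite -nb_edgesE spread_fill // size_fill //.
have -> : ((fill d.+1 s).2 != [::]) = 1 :> nat.
  by have := size_fill _ _ ds; case: (fill d.+1 s).2.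
by case: (fill d.+1 s) vt => t v /= vt vs vd; split=> //=; lia.
Qed.

Theorem corollary2 (n i : nat) (hn : (1 <= n)%N) (hi : (1 <= i)%N) :
  [set Tv : ptree * seq nat | [/\ nb_edges Tv.1 = n,
                                  Tv.2 \in vertices Tv.1
                                & degree Tv.1 Tv.2 = i]]
  #= `I_(2 * binz (2 * n%:Z - i%:Z - 1)%R (n%:Z - 1)%R)%N.
Proof.
case: i hi => // i _; case: (leqP i.+1 n) => [|ni]; last first.
  have -> : binz (2 * n%:Z - i.+1%:Z - 1)%R (n%:Z - 1)%R = 0.
    by rewrite /binz ifF //; lia.
  (* A degree above [n] would force [spread v t] to have more trees than vertices. *)
  rewrite muln0 II0 card_eq0; apply/eqP/seteqP; split=> // -[t v] /= [tn vt ti].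
  have := degreeE _ _ vt; have := forest_size_spread _ _ vt.
  have := leq_forest_size (spread v t); have := size_spread v t.
  rewrite -nb_edgesE tn ti; case: v {vt ti} => [|k v] /=; lia.
move=> /subnKC; move: (n - i.+1) => m nE; rewrite -nE {n hn nE}.
have -> : binz (2 * (i.+1 + m)%:Z - i.+1%:Z - 1)%R ((i.+1 + m)%:Z - 1)%R
    = 'C(m.*2 + i, m).
  rewrite /binz ifT; last lia.
  (* With [n = i + 1 + m] the lower index is [i + m], the complement of [m] in [2m + i]. *)
  rewrite -[in RHS]bin_sub; last lia.
  by congr 'C(_, _); lia.
have [a ka] := card_forests i.+1 m.
have kb := card_marked_forests i.+1 m.
rewrite addnS /= => aE.
have -> : 2 * 'C(m.*2 + i, m) = a + 'C(m.*2 + i.+1, m).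
  rewrite -aE; case: m aE {ka kb} => [|m]; first by rewrite !bin0; lia.
  by rewrite addnS binS; lia.
apply: (card_setU_image _ _ _ _ _ _ _ _ _ _ ka kb _ _ _ (vertices_of_degreeE _ _)).
- by move=> s s' _ _ [].
- move=> [d s] [d' s']; rewrite !inE => -[/= sk _] [/= sk' _] e.
  have ds : d.+1.*2 <= size s by lia.
  have ds' : d'.+1.*2 <= size s' by lia.
  (* [spread] recovers the sequence, and the length of the position recovers the depth. *)
  have := spread_fill _ _ ds; rewrite e spread_fill // => ->.
  by have := size_fill _ _ ds; rewrite e size_fill // => -[->].
- move=> s [d s'] _ [/= sk _] /(congr1 snd) /= e.
  have ds : d.+1.*2 <= size s' by lia.
  by have := size_fill _ _ ds; rewrite -e.
Qed.
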